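(* Let $T$ and $B$ be lattice paths with steps $N=(0,1)$ and $E=(1,0)$ from the origin to a point $(x,y)\in\mathbb N^2$, with $T$ weakly above $B$. Then the pairs of statistics $(b,\ell)$ and $(t,r)$ have the same joint distribution over $\mathcal P(T,B)$, i.e. $$\sum_{P\in\mathcal P(T,B)} u^{b(P)}v^{\ell(P)}=\sum_{P\in\mathcal P(T,B)} u^{t(P)}v^{r(P)}.$$
   Context: $T$ weakly above $B$ means no point of $T$ is strictly below or strictly to the right of $B$. $\mathcal P(T,B)$ is the set of lattice paths with steps $N$ and $E$ from the origin to $(x,y)$ lying weakly above $B$ and weakly below $T$. For $P\in\mathcal P(T,B)$: $t(P)$ is the number of top contacts (east steps of $P$ that are also steps of $T$), $b(P)$ the number of bottom contacts (east steps of $P$ that are also steps of $B$), $\ell(P)$ the number of left contacts (north steps of $P$ that are also steps of $T$), and $r(P)$ the number of right contacts (north steps of $P$ that are also steps of $B$). *)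

(* Defs.v *)
From HB Require Import structures.
From mathcomp Require Import all_boot.
Set Implicit Arguments.
Unset Strict Implicit.
Unset Printing Implicit Defensive.

Variant step := North | East.

Definition bool_of_step (s : step) : bool := if s is North then true else false.
Definition step_of_bool (b : bool) : step := if b then North else East.
Lemma bool_of_stepK : cancel bool_of_step step_of_bool.
Proof. by case. Qed.
HB.instance Definition _ := Finite.copy step (can_type bool_of_stepK).

Definition origin : nat * nat := (0, 0).

Definition move (p : nat * nat) (s : step) : nat * nat :=
  if s is North then (p.1, p.2.+1) else (p.1.+1, p.2).

Definition points (P : seq step) : seq (nat * nat) := origin :: scanl move origin P.

Definition end_point (P : seq step) : nat * nat := last origin (points P).

(* A step situated in the plane is its starting point together with its
   direction; [zip] drops the end point of the path, where no step starts. *)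
Definition steps (P : seq step) : seq ((nat * nat) * step) := zip (points P) P.

(* The vertical line through p meets the path Q, and only strictly above p. *)
Definition strictly_below (p : nat * nat) (Q : seq step) : bool :=
  has (fun q => q.1 == p.1) (points Q) &&
  all (fun q => (q.1 == p.1) ==> (p.2 < q.2)) (points Q).

(* The horizontal line through p meets the path Q, and only strictly to the
   left of p. *)
Definition strictly_right (p : nat * nat) (Q : seq step) : bool :=
  has (fun q => q.2 == p.2) (points Q) &&
  all (fun q => (q.2 == p.2) ==> (q.1 < p.1)) (points Q).

(* For paths with unit steps and common end points it is enough to test the
   lattice points. *)
Definition weakly_above (P Q : seq step) : bool :=
  all (fun p => ~~ strictly_below p Q && ~~ strictly_right p Q) (points P).

Definition weakly_below (P Q : seq step) : bool := weakly_above Q P.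

(* A path from the origin to (x, y) has exactly x + y steps. *)
Definition paths_between (x y : nat) (T B : seq step) : {set (x + y).-tuple step} :=
  [set P : (x + y).-tuple step |
    [&& end_point P == (x, y), weakly_above P B & weakly_below P T]].

Definition contacts (d : step) (P Q : seq step) : nat :=
  count (fun e => (e.2 == d) && (e \in steps Q)) (steps P).

Definition top_contacts (T P : seq step) : nat := contacts East P T.
Definition bottom_contacts (B P : seq step) : nat := contacts East P B.
Definition left_contacts (T P : seq step) : nat := contacts North P T.
Definition right_contacts (B P : seq step) : nat := contacts North P B.

(* Main.v *)
(** A path is a basis of a lattice path matroid (its north steps).  For the order
of the ground set along the path, bottom and left contacts are the externally
and internally active elements; for the reverse order these are the top and
right contacts.  So the claim says that the Tutte polynomial does not depend on
the choice between these two orders.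

Deletion-contraction of the last step computes the first generating function
([backward]), deletion-contraction of the first step the second one ([forward]).
They agree by induction on the length: removing the last and then the first
step, or the other way round, leads to the same four minors, with equal
coefficients except when first and last step are parallel or in series; in that
case the two mixed minors coincide. *)
Require Import Defs.
From HB Require Import structures.
From mathcomp Require Import all_boot all_order all_algebra.
From mathcomp Require Import zify ring.
Set Implicit Arguments.
Unset Strict Implicit.
Unset Printing Implicit Defensive.
Import Order.TTheory GRing.Theory Num.Theory.
Local Open Scope ring_scope.

(** * Routes in a region of pairs (index, height) *)

Section Region.
(* [A i h]: a path may have taken [h] north steps among its first [i] steps.  Heights
   are integers so that [k - 1] needs no case distinction at [k = 0]. *)
Variable A : nat -> int -> bool.

Fixpoint reach (i : nat) (h : int) (n : nat) (k : int) : bool :=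
  A (i + n)%N k &&
  (if n is m.+1 then reach i h m k || reach i h m (k - 1) else k == h).

Definition route (i : nat) (h : int) (n : nat) (k : int) (f : nat -> int) : Prop :=
  [/\ f 0%N = h, f n = k,
      forall j, (j < n)%N -> f j <= f j.+1 <= f j + 1 &
      forall j, (j <= n)%N -> A (i + j)%N (f j)].

(** Height functions can be shifted, extended and combined by pointwise [min] and [max]; all later
    facts about [reach] rest on this. *)
Lemma reachP i h n k : reflect (exists f, route i h n k f) (reach i h n k).
Proof.
apply: (iffP idP).
  elim: n k => [|n IHn] k /= /andP[Ak].
    move/eqP=> kh; exists (fun=> h); split=> // j.
    by rewrite leqn0 => /eqP->; rewrite -kh.
  have ext k' : k' <= k <= k' + 1 -> reach i h n k' -> exists f, route i h n.+1 k f.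
    move=> kk' /IHn[f [f0 fn fS fA]].
    exists (fun j => if (j <= n)%N then f j else k); split=> //=.
    - by rewrite ltnn.
    - move=> j /=; rewrite ltnS; case: ltngtP => // [jn|->] _; last by rewrite fn.
      exact: fS.
    - by move=> j jn; case: leqP => [/fA//|nj]; have -> : j = n.+1 by lia.
  by case/orP; apply: ext; lia.
case=> f; elim: n k => [|n IHn] k [f0 fn fS fA] /=.
  by rewrite -{1}fn fA //= -fn f0.
rewrite -{1}fn fA //=.
have r : reach i h n (f n).
  by apply: IHn; split=> // j jn; [apply: fS | apply: fA]; apply: ltnW.
have := fS n (ltnSn n); rewrite fn => b.
have [e|e] : f n = k \/ f n = k - 1 by lia.
  by rewrite -e r.
by rewrite -e r orbT.
Qed.

(** [reach] peels off the last step; shifting the route by one index peels off the first one, which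
    is how [forward] recurses. *)
Lemma reachSl i h n k :
  reach i h n.+1 k = A i h && (reach i.+1 h n k || reach i.+1 (h + 1) n k).
Proof.
apply/reachP/andP.
  case=> f [f0 fn fS fA]; split; first by rewrite -f0 -(addn0 i) fA.
  have tl h' : f 1%N = h' -> reach i.+1 h' n k.
    move=> f1; apply/reachP; exists (fun j => f j.+1); split=> // j jn.
      exact: fS.
    by rewrite addSnnS; apply: fA.
  have := fS 0%N isT; rewrite f0 => b.
  have [e|e] : f 1%N = h \/ f 1%N = h + 1 by lia.
    by rewrite (tl _ e).
  by rewrite (tl _ e) orbT.
case=> Ah.
have ext h' : h <= h' <= h + 1 -> reach i.+1 h' n k -> exists f, route i h n.+1 k f.
  move=> hh' /reachP[f [f0 fn fS fA]].
  exists (fun j => if j is j'.+1 then f j' else h); split=> //=.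
  - by case=> [|j] jn; [rewrite f0 | apply: fS].
  - by case=> [|j] jn; [rewrite addn0 | rewrite -addSnnS fA].
by case/orP; apply: ext; lia.
Qed.

Lemma route_bounds i h n k f j : route i h n k f -> (j <= n)%N ->
  [/\ h <= f j, f j <= h + j%:Z, f j <= k & k <= f j + (n - j)%N%:Z].
Proof.
case=> f0 fn fS _ jn.
have up d : (d <= n)%N -> h <= f d <= h + d%:Z.
  elim: d => [|d IHd] dn; first by lia.
  by have := fS d dn; have := IHd (ltnW dn); lia.
have down d : (d <= n)%N -> f (n - d)%N <= k <= f (n - d)%N + d%:Z.
  elim: d => [|d IHd] dn; first by rewrite subn0 fn; lia.
  have := fS (n - d.+1)%N; have := IHd (ltnW dn).
  have -> : (n - d.+1).+1 = (n - d)%N by lia.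
  by move=> ? H; have := H ltac:(lia); lia.
have := up j jn; have := down (n - j)%N (leq_subr _ _).
by rewrite subKn // => *; split; lia.
Qed.

Hypothesis A_convex : forall i a b c, A i a -> A i c -> a <= b <= c -> A i b.

(** * Exchanging the first and the last step of a route *)

Section Exchange.
Variables (i n : nat) (h k : int).
(** The two letters are the first and the last step of a route of length [n + 2]; reachability
    concerns the [n] steps in between. *)
Let NN := reach i (h + 1) n (k - 1).
Let NE := reach i (h + 1) n k.
Let EN := reach i h n (k - 1).
Let EE := reach i h n k.

(** The pointwise maximum of the two routes runs from [h + 1] to [k]; their minimum, from [h] to
    [k - 1], serves [reach_meet]. *)
Lemma reach_join : NN -> EE -> NE.
Proof.
move=> /reachP[f1 p1] /reachP[f2 p2].
have [f10 f1n f1S f1A] := p1; have [f20 f2n f2S f2A] := p2.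
apply/reachP; exists (fun j => Num.max (f1 j) (f2 j)); split; try lia.
- by move=> j jn; have := f1S _ jn; have := f2S _ jn; lia.
- by move=> j jn; case: (leP (f1 j) (f2 j)) => _; [apply: f2A | apply: f1A].
Qed.

Lemma reach_meet : NN -> EE -> EN.
Proof.
move=> /reachP[f1 p1] /reachP[f2 p2].
have [f10 f1n f1S f1A] := p1; have [f20 f2n f2S f2A] := p2.
apply/reachP; exists (fun j => Num.min (f1 j) (f2 j)); split; try lia.
- by move=> j jn; have := f1S _ jn; have := f2S _ jn; lia.
- by move=> j jn; case: (leP (f1 j) (f2 j)) => _; [apply: f1A | apply: f2A].
Qed.

(** Cap the NE route at height [k - 1], which is not below its start. Where the cap acts, [k - 1]
    lies between the EN and the NE route, so convexity applies. *)
Lemma reach_cap : NE -> EN -> h + 1 < k -> NN.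
Proof.
move=> /reachP[f1 p1] /reachP[f2 p2] hk.
have [f10 f1n f1S f1A] := p1; have [f20 f2n f2S f2A] := p2.
apply/reachP; exists (fun j => Num.min (f1 j) (k - 1)); split; try lia.
- by move=> j jn; have := f1S _ jn; lia.
- move=> j jn; case: (leP (f1 j) (k - 1)) => c; first exact: f1A.
  apply: (A_convex (f2A _ jn) (f1A _ jn)).
  by have [_ _ b _] := route_bounds p2 jn; lia.
Qed.

(** Raise the EN route to the line of slope one that ends at [k]. This line starts at most at [h]
    and never exceeds the NE route, so convexity applies where it overtakes the EN route. *)
Lemma reach_cup : NE -> EN -> k <= h + n%:Z -> EE.
Proof.
move=> /reachP[f1 p1] /reachP[f2 p2] hk.
have [f10 f1n f1S f1A] := p1; have [f20 f2n f2S f2A] := p2.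
apply/reachP; exists (fun j => Num.max (f2 j) (k + j%:Z - n%:Z)); split; try lia.
- by move=> j jn; have := f2S _ jn; lia.
- move=> j jn.
  case: (leP (f2 j) (k + j%:Z - n%:Z)) => c; last exact: f2A.
  apply: (A_convex (f2A _ jn) (f1A _ jn)).
  by have [_ _ _ b] := route_bounds p1 jn; lia.
Qed.
End Exchange.

(** * The two deletion-contraction recursions and their equality *)

Section Tutte.
Variables (R : comNzRingType) (u v : R).

(* A step gets weight [u] or [v] when no path could take the other direction
   instead, that is, when it is a loop or a coloop of the current minor. *)
Fixpoint backward i h n k : R :=
  if A (i + n)%N k then
    if n is m.+1 then
      (if reach i h m k then 1 else v) * backward i h m (k - 1) +
      (if reach i h m (k - 1) then 1 else u) * backward i h m k
    else (k == h)%:R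
  else 0.

Fixpoint forward i h n k : R :=
  if A i h then
    if n is m.+1 then
      (if reach i.+1 h m k then 1 else v) * forward i.+1 (h + 1) m k +
      (if reach i.+1 (h + 1) m k then 1 else u) * forward i.+1 h m k
    else (k == h)%:R
  else 0.

Lemma backward0 i h n k : ~~ reach i h n k -> backward i h n k = 0.
Proof.
elim: n k => [|n IHn] k /=; case: (A _ k) => //=; first by move/negPf->.
by rewrite negb_or => /andP[rk rk1]; rewrite !IHn // !mulr0 addr0.
Qed.

Lemma forward0 i h n k : ~~ reach i h n k -> forward i h n k = 0.
Proof.
elim: n i h => [|n IHn] i h.
  rewrite /= addn0; have [->|_] := eqVneq k h; last by case: (A i h).
  by rewrite andbT => /negPf->.
rewrite reachSl /=; case: (A i h) => //=.
by rewrite negb_or => /andP[rk rk1]; rewrite !IHn // !mulr0 addr0.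
Qed.

Lemma reach_le i h n k : reach i h n k -> h <= k <= h + n%:Z.
Proof.
by move/reachP=> [f p]; have [] := route_bounds p (leqnn n); case: p => _ -> _ _; lia.
Qed.

(** The final height is already attained, so each step is a forced East of weight [u]. *)
Lemma forward_flat i h n : reach i h n h -> forward i h n h = u ^+ n.
Proof.
elim: n i => [|n IHn] i; first by rewrite /= addn0 eqxx andbT => ->.
rewrite reachSl /= => /andP[->].
have /negPf no : ~~ reach i.+1 (h + 1) n h by apply/negP=> /reach_le; lia.
rewrite no orbF => r; rewrite r IHn // forward0 ?no //.
by rewrite mulr0 add0r exprS.
Qed.

Lemma forward_steep i h n :
  reach i h n (h + n%:Z) -> forward i h n (h + n%:Z) = v ^+ n.
Proof.
elim: n i h => [|n IHn] i h; first by rewrite /= addn0 addr0 eqxx andbT => ->.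
rewrite reachSl /= => /andP[->].
have /negPf no : ~~ reach i.+1 h n (h + n.+1%:Z) by apply/negP=> /reach_le; lia.
rewrite no /= (forward0 (negbT no)) mulr0 addr0.
have -> : h + n.+1%:Z = h + 1 + n%:Z by lia.
by move=> r; rewrite IHn // exprS.
Qed.

(* When one of the corners NN, EE is unreachable, the first and the last step
   are parallel or in series, and exchanging them identifies NE with EN. *)
Lemma forward_exchange i h n k :
  reach i (h + 1) n k -> reach i h n (k - 1) ->
  ~~ (reach i (h + 1) n (k - 1) && reach i h n k) ->
  forward i (h + 1) n k = forward i h n (k - 1).
Proof.
move=> ne en; rewrite negb_and => /orP[nn|ee].
  (* By [reach_cap], an unreachable NN leaves only this height; both sides are then flat and equal
     [u ^+ n]. *)
  have kE : k = h + 1.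
    case: (ltrP (h + 1) k) => [/(reach_cap ne en) r|]; first by rewrite r in nn.
    by have := reach_le ne; lia.
  have e : k - 1 = h by lia.
  by move: ne en; rewrite e kE => ne en; rewrite !forward_flat.
(* By [reach_cup], an unreachable EE leaves only this height; both sides are then steep and equal
   [v ^+ n]. *)
have kE : k = h + 1 + n%:Z.
  case: (lerP k (h + n%:Z)) => [/(reach_cup ne en) r|]; first by rewrite r in ee.
  by have := reach_le ne; lia.
have e : k - 1 = h + n%:Z by lia.
by move: ne en; rewrite e kE => ne en; rewrite !forward_steep.
Qed.

Theorem backward_forward i h n k : backward i h n k = forward i h n k.
Proof.
(* Lengths 0 and 1 are computed directly: the first and the last step are distinct only from length
   2 on. *)
elim/ltn_ind: n i h k => -[|[|m]] IHn i h k.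
- by rewrite /= addn0; have [->//|_] := eqVneq k h; case: (A i k); case: (A i h).
- rewrite /= !addn0 addn1 subr_eq.
  have [->|kh] := eqVneq k h.
    have /negPf -> : h != h + 1 by lia.
    by rewrite !andbF !andbT !if_same; case: (A i h); case: (A i.+1 h);
       rewrite ?mulr0 ?mulr1 ?add0r.
  have [->|kh1] := eqVneq k (h + 1).
    have -> : h + 1 - 1 = h by lia.
    by rewrite !andbF !andbT !if_same; case: (A i h); case: (A i.+1 (h + 1));
       rewrite ?mulr0 ?mulr1 ?addr0.
  by rewrite !andbF !if_same !mulr0 addr0 !if_same.
have [r|r] := boolP (reach i h m.+2 k); last by rewrite backward0 // forward0.
have Ak : A (i + m.+2)%N k by case/andP: r.
have Ah : A i h by move: r; rewrite reachSl => /andP[].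
have rS k1 : reach i h m.+1 k1 = reach i.+1 h m k1 || reach i.+1 (h + 1) m k1.
  by rewrite reachSl Ah.
have rP h1 : reach i.+1 h1 m.+1 k = reach i.+1 h1 m k || reach i.+1 h1 m (k - 1).
  by rewrite /= addSnnS Ak.
(* The induction hypothesis switches between the recursions, so that both sides become combinations
   of [forward] at the same four middle pieces. *)
have bS k1 : backward i h m.+1 k1 =
    (if reach i.+1 h m k1 then 1 else v) * forward i.+1 (h + 1) m k1 +
    (if reach i.+1 (h + 1) m k1 then 1 else u) * forward i.+1 h m k1.
  by rewrite IHn //= Ah.
have fP h1 : forward i.+1 h1 m.+1 k =
    (if reach i.+1 h1 m k then 1 else v) * forward i.+1 h1 m (k - 1) +
    (if reach i.+1 h1 m (k - 1) then 1 else u) * forward i.+1 h1 m k.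
  by rewrite -IHn //= addSnnS Ak !IHn.
have -> : backward i h m.+2 k =
    (if reach i h m.+1 k then 1 else v) * backward i h m.+1 (k - 1) +
    (if reach i h m.+1 (k - 1) then 1 else u) * backward i h m.+1 k.
  by rewrite {1}/backward Ak.
have -> : forward i h m.+2 k =
    (if reach i.+1 h m.+1 k then 1 else v) * forward i.+1 (h + 1) m.+1 k +
    (if reach i.+1 (h + 1) m.+1 k then 1 else u) * forward i.+1 h m.+1 k.
  by rewrite {1}/forward Ah.
rewrite !bS !fP !rS !rP {rS rP bS fP}.
(* Of the 16 reachability patterns, join and meet exclude those with NN and EE but not both mixed
   corners. Elsewhere unreachable corners vanish, and [forward_exchange] settles the case where NE
   and EN are reachable but not all four corners. *)
have := @reach_join i.+1 m h k; have := @reach_meet i.+1 m h k.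
have := @forward_exchange i.+1 h m k.
have := @forward0 i.+1 h m k; have := @forward0 i.+1 (h + 1) m k.
have := @forward0 i.+1 h m (k - 1); have := @forward0 i.+1 (h + 1) m (k - 1).
case: (reach i.+1 (h + 1) m (k - 1)); case: (reach i.+1 h m k);
  case: (reach i.+1 (h + 1) m k); case: (reach i.+1 h m (k - 1)) => /=;
  try (by move=> _ _ _ _ _ /(_ isT isT)); try (by move=> _ _ _ _ _ _ /(_ isT isT));
  move=> z1 z2 z3 z4 x _ _;
  try rewrite (z1 isT); try rewrite (z2 isT); try rewrite (z3 isT);
  try rewrite (z4 isT); try rewrite (x isT isT isT); ring.
Qed.

End Tutte.
End Region.

(** * Heights, points and steps of a lattice path *)

Definition height (Q : seq step) (i : nat) : nat := count_mem North (take i Q).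

(** An arbitrary starting point permits induction on the first step. *)
Definition points_from (p : nat * nat) (P : seq step) := p :: scanl move p P.
Definition steps_from (p : nat * nat) (P : seq step) := zip (points_from p P) P.
Definition contacts_from p (d : step) (P Q : seq step) : nat :=
  count (fun e => (e.2 == d) && (e \in steps Q)) (steps_from p P).

Lemma foldl_move p P :
  foldl move p P = (p.1 + (size P - count_mem North P), p.2 + count_mem North P)%N.
Proof.
elim: P p => [|s P IHP] [a b] /=; first by rewrite !addn0.
have := count_size (pred1 North) P.
by rewrite IHP; case: s => /= cP; congr pair; lia.
Qed.

Lemma last_points p P : last p (scanl move p P) = foldl move p P.
Proof. by elim: P p => //= s P IHP p; rewrite IHP. Qed.

Lemma end_pointE P : end_point P = ((size P - count_mem North P)%N, count_mem North P).
Proof. by rewrite /end_point /= last_points foldl_move. Qed.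

Lemma height_le Q i : (height Q i <= i)%N.
Proof. by rewrite (leq_trans (count_size _ _)) // size_take_min geq_minl. Qed.

Lemma nth_points x0 Q i : (i <= size Q)%N ->
  nth x0 (points Q) i = ((i - height Q i)%N, height Q i).
Proof. by move=> iQ; rewrite nth_cons_scanl // foldl_move size_takel. Qed.

Lemma size_points Q : size (points Q) = (size Q).+1.
Proof. by rewrite /= size_scanl. Qed.

Lemma height0 Q : height Q 0 = 0%N.
Proof. by rewrite /height take0. Qed.

Lemma height_oversize Q i : (size Q <= i)%N -> height Q i = count_mem North Q.
Proof. by move=> Qi; rewrite /height take_oversize. Qed.

(** The default [East] keeps the formula valid past the end, where the height is constant. *)
Lemma heightS Q i : height Q i.+1 = (height Q i + (nth East Q i == North))%N.
Proof.
have [iQ|Qi] := ltnP i (size Q).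
  by rewrite /height (take_nth East iQ) -cats1 count_cat /= addn0.
by rewrite !height_oversize ?nth_default ?addn0 // ltnW.
Qed.

Lemma height_mono Q i j :
  (i <= j)%N -> (height Q i <= height Q j <= height Q i + (j - i))%N.
Proof.
elim: j => [|j IHj]; first by rewrite leqn0 => /eqP->; rewrite height0.
rewrite leq_eqVlt => /predU1P[->|]; first by rewrite subnn addn0 leqnn.
rewrite ltnS => ij; have := IHj ij; rewrite heightS.
by case: (_ == _) => /=; lia.
Qed.

(** Every step leads to the next antidiagonal, so [(a, b)] can occur only at index [a + b]. *)
Lemma mem_points a b Q :
  ((a, b) \in points Q) = (a + b <= size Q)%N && (height Q (a + b) == b).
Proof.
apply/(nthP origin)/andP.
  case=> i; rewrite size_points ltnS => iQ; rewrite nth_points // => -[<- <-].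
  by rewrite subnK ?height_le.
case=> abQ /eqP hb; exists (a + b)%N; first by rewrite size_points.
by rewrite nth_points // hb addnK.
Qed.

Lemma mem_steps a b s Q :
  ((a, b, s) \in steps Q) =
    [&& (a + b < size Q)%N, nth East Q (a + b) == s & height Q (a + b) == b].
Proof.
have szS : size (steps Q) = size Q.
  by rewrite size_zip size_points; apply/minn_idPr.
have nthS i : (i < size Q)%N ->
    nth (origin, East) (steps Q) i = ((i - height Q i)%N, height Q i, nth East Q i).
  by move=> iQ; rewrite nth_zip_cond szS iQ nth_points // ltnW.
apply/(nthP (origin, East))/and3P.
  case=> i; rewrite szS => iQ; rewrite nthS // => -[<- <- <-].
  by rewrite subnK ?height_le.
case=> abQ /eqP<- /eqP hb; exists (a + b)%N; first by rewrite szS.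
by rewrite nthS // hb addnK.
Qed.

(** Discrete intermediate values: the abscissa grows by at most one per step. *)
Lemma height_hits_abscissa Q a i :
  (i - height Q i <= a <= size Q - count_mem North Q)%N -> (i <= size Q)%N ->
  exists2 j, (i <= j <= size Q)%N & (j - height Q j = a)%N.
Proof.
move=> + iQ; rewrite -(height_oversize (leqnn _)).
have [d dQ] : exists d, size Q = (i + d)%N by exists (size Q - i)%N; lia.
rewrite dQ; elim: d {dQ} => [|d IHd]; first by rewrite addn0 => h; exists i; lia.
rewrite addnS => h.
have [le|gt] := leqP a (i + d - height Q (i + d)).
  by have [|j jb ja] := IHd; [lia | exists j; lia].
exists (i + d).+1; first by lia.
by have := heightS Q (i + d); case: (_ == _) => /=; lia.
Qed.

Lemma end_point_size P x y : end_point P = (x, y) -> size P = (x + y)%N.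
Proof. by rewrite end_pointE => -[<- <-]; rewrite subnK // count_size. Qed.

(** Turns the comparison along vertical and horizontal lines into one along antidiagonals, that is,
    index by index. *)
Lemma weakly_aboveP P Q : end_point P = end_point Q ->
  reflect (forall i, (height Q i <= height P i)%N) (weakly_above P Q).
Proof.
case E : (end_point Q) => [x y] EP.
have sP := end_point_size EP; have sQ := end_point_size E.
move: EP E; rewrite !end_pointE => -[_ NP] [EQ NQ].
apply: (iffP allP) => [above i | le p].
  have [iQ|Qi] := leqP i (size Q); last first.
    by rewrite !height_oversize ?NP ?NQ // ltnW // sP -sQ.
  rewrite leqNgt; apply/negP => lt.
  (* This point would be strictly below [Q]: at index [i], [Q] is further left and higher, and it
     meets this vertical only later. *)
  have pP : ((i - height P i)%N, height P i) \in points P.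
    by rewrite mem_points subnK ?height_le // eqxx sP -sQ iQ.
  have /andP[/negP + _] := above _ pP; apply; apply/andP; split => /=.
    have [||j jQ ja] := @height_hits_abscissa Q (i - height P i)%N i; [|exact: iQ|].
      have iP : (i <= size P)%N by rewrite sP -sQ.
      have := height_mono P iP; rewrite (height_oversize (leqnn _)) NP NQ sP sQ. lia.
    rewrite -[_ || _]/(has _ (points Q)).
    apply/hasP; exists ((j - height Q j)%N, height Q j); last by rewrite /= ja.
    by rewrite mem_points subnK ?height_le //; lia.
  rewrite -[_ && _]/(all _ (points Q)).
  apply/allP => -[a b]; rewrite mem_points /= => /andP[abQ /eqP hb].
  apply/implyP=> /eqP e.
  have := height_le P i; have := height_le Q i.
  have [le|/ltnW le] := leqP (a + b)%N i; have := height_mono Q le; lia.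
case: p => a b; rewrite mem_points => /andP[abP /eqP hb].
have := le (a + b)%N; rewrite hb => le_ab.
have h_ab := height_le Q (a + b).
apply/andP; split; apply/negP => /andP[/hasP[[c d] + /eqP e] /allP all_b];
  rewrite mem_points => /andP[cdQ /eqP hd]; rewrite /= in e; subst.
  (* [Q] avoids [(a, b)], so its height at index [a + b] is below [b]; it cannot climb to [d] by
     index [a + d]. *)
  have := all_b (a, b); rewrite mem_points /= eqxx ltnn => H.
  have := all_b (a, d); rewrite mem_points cdQ hd eqxx /= => /(_ isT) bd.
  have := height_mono Q (i := (a + b)%N) (j := (a + d)%N).
  by move: H; rewrite -sP in sQ; rewrite sQ abP /=; case: eqP => // ? H; lia.
(* [Q] has height [b] at the earlier index [c + b] and at most [b] at [a + b], so it passes through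
   [(a, b)], a contradiction. *)
have := all_b (a, b); rewrite mem_points /= eqxx ltnn => H.
have := all_b (c, b); rewrite mem_points cdQ hd eqxx /= => /(_ isT) ca.
have := height_mono Q (i := (c + b)%N) (j := (a + b)%N).
by move: H; rewrite -sP in sQ; rewrite sQ abP /=; case: eqP => // ? H; lia.
Qed.

(** * Words as lists, so that sums split at the first or the last letter *)

Fixpoint words (n : nat) : seq (seq step) :=
  if n is m.+1 then map (cons North) (words m) ++ map (cons East) (words m)
  else [:: [::]].

Lemma mem_words n w : (w \in words n) = (size w == n).
Proof.
elim: n w => [|n IHn] [|s w] //=.
  by rewrite mem_cat; apply/negbTE/norP; split; apply/mapP => -[].
rewrite eqSS -IHn mem_cat; case: s.
  rewrite mem_map; last by move=> ? ? [].
  by rewrite orbC; case: mapP => // -[].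
rewrite orbC mem_map; last by move=> ? ? [].
by rewrite orbC; case: mapP => // -[].
Qed.

Lemma uniq_words n : uniq (words n).
Proof.
elim: n => //= n IHn; rewrite cat_uniq !map_inj_uniq ?IHn /=; try by move=> ? ? [].
by rewrite andbT; apply/hasPn => _ /mapP[w _ ->]; apply/mapP => -[].
Qed.

Section Sums.
Variable R : comNzRingType.
Implicit Type F : seq step -> R.

Lemma sum_tuples n (P : pred (seq step)) F :
  \sum_(t : n.-tuple step | P t) F t = \sum_(w <- words n | P w) F w.
Proof.
rewrite -(big_map val P F); apply: perm_big; apply: uniq_perm.
- by rewrite map_inj_uniq ?index_enum_uniq //; apply: val_inj.
- exact: uniq_words.
move=> w; rewrite mem_words; apply/mapP/eqP => [[t _ ->]|sw]; first exact: size_tuple.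
by exists (Tuple (introT eqP sw)); rewrite ?mem_index_enum.
Qed.

Lemma sum_words_cons n (P : pred (seq step)) F :
  \sum_(w <- words n.+1 | P w) F w =
    \sum_(w <- words n | P (North :: w)) F (North :: w) +
    \sum_(w <- words n | P (East :: w)) F (East :: w).
Proof. by rewrite /= big_cat !big_map. Qed.

Lemma sum_words_rcons n (P : pred (seq step)) F :
  \sum_(w <- words n.+1 | P w) F w =
    \sum_(w <- words n | P (rcons w North)) F (rcons w North) +
    \sum_(w <- words n | P (rcons w East)) F (rcons w East).
Proof.
elim: n P F => [|n IHn] P F; first by rewrite sum_words_cons /= !big_cons !big_nil.
rewrite [X in _ = X + _]sum_words_cons [X in _ = _ + X]sum_words_cons.
by rewrite sum_words_cons !IHn /= addrACA.
Qed.
End Sums.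

Lemma steps_from_rcons p P s :
  steps_from p (rcons P s) = rcons (steps_from p P) (foldl move p P, s).
Proof. by elim: P p => //= s' P IHP p; congr cons; apply: IHP. Qed.

Lemma contacts_rcons d P s Q :
  contacts d (rcons P s) Q =
  (contacts d P Q + ((s == d) && ((end_point P, s) \in steps Q)))%N.
Proof.
rewrite /contacts -[steps (rcons P s)]/(steps_from origin _) steps_from_rcons.
by rewrite -cats1 count_cat /= addn0 /end_point /= last_points.
Qed.

Lemma count_rcons_North P s :
  count_mem North (rcons P s) = (count_mem North P + (s == North))%N.
Proof. by rewrite -cats1 count_cat /= addn0. Qed.

(** * The region between the two boundary paths *)

Section Boundaries.
Variables (T B : seq step) (n y : nat).
Hypotheses (sT : size T = n) (sB : size B = n).
Hypotheses (yT : count_mem North T = y) (yB : count_mem North B = y).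
Hypothesis leBT : forall i, (height B i <= height T i)%N.

Definition allowed (i : nat) (h : int) : bool :=
  (height B i)%:Z <= h <= (height T i)%:Z.

Lemma allowed_convex i a b c : allowed i a -> allowed i c -> a <= b <= c -> allowed i b.
Proof. by rewrite /allowed; lia. Qed.

(** Follow [T] up to height [h], then go east. The tests in [backward] thus reduce to [allowed]. *)
Lemma reach_from_origin i h : reach allowed 0 0 i h = allowed i h.
Proof.
apply/reachP/idP => [[f [_ <- _ /(_ _ (leqnn i))]] //|/andP[Bh hT]].
exists (fun j => Num.min (height T j)%:Z h); split; rewrite ?height0.
- by lia.
- by lia.
- by move=> j _; rewrite heightS; case: (_ == _) => /=; lia.
- move=> j ji; have := height_mono B ji; have := leBT j.
  by rewrite /allowed add0n; lia.
Qed.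

(** Go east until [B] is met, then follow [B]. The tests in [forward] thus reduce to [allowed]. *)
Lemma reach_to_end i h m : (i + m)%N = n -> reach allowed i h m y%:Z = allowed i h.
Proof.
move=> imn; have hn (Q : seq step) : size Q = n -> height Q (i + m) = count_mem North Q.
  by move=> sQ; rewrite height_oversize // sQ imn.
apply/reachP/idP => [[f [<- _ _ /(_ 0%N isT)]]|/andP[Bh hT]]; first by rewrite addn0.
exists (fun j => Num.max (height B (i + j))%:Z h); split.
- by rewrite addn0; lia.
- have := height_mono T (leq_addr m i).
  by rewrite !hn // yT yB; lia.
- by move=> j _; rewrite addnS heightS; case: (_ == _) => /=; lia.
- move=> j jm; have := height_mono T (leq_addr j i); have := leBT (i + j).
  by rewrite /allowed; lia.
Qed.

Definition inside (p : nat * nat) (P : seq step) : bool :=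
  all (fun q => allowed (q.1 + q.2) q.2%:Z) (points_from p P).

Lemma inside_cons p s P :
  inside p (s :: P) = allowed (p.1 + p.2) p.2%:Z && inside (move p s) P.
Proof. by []. Qed.

Lemma inside_rcons P s :
  inside origin (rcons P s) =
  inside origin P && allowed (size P).+1 (count_mem North P + (s == North))%N%:Z.
Proof.
rewrite /inside /points_from scanl_rcons -rcons_cons all_rcons andbC; congr (_ && _).
by rewrite foldl_move !add0n subnK ?count_size // size_rcons count_rcons_North.
Qed.

Lemma inside_last P : inside origin P -> allowed (size P) (count_mem North P)%:Z.
Proof.
case/lastP: P => [|P s]; first by case/andP.
rewrite inside_rcons size_rcons => /andP[_].
by rewrite -[rcons P s]cats1 count_cat /= addn0.
Qed.

Lemma eq_East (s : step) : (s == East) = (s != North).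
Proof. by case: s. Qed.

(** * Contacts as forced steps *)

Section Contact.
Variables a b : nat.
Hypotheses (abn : (a + b < n)%N) (here : allowed (a + b) b%:Z).

(** If [b - 1] is forbidden, [B] passes through [(a, b)], and it leaves eastwards because [b] is
    allowed next. Bottom and left contacts are tested at the index before the step, which suits
    [backward]; top and right contacts at the index after it, which suits [forward]. *)
Lemma contactB_East : allowed (a + b).+1 b%:Z ->
  ((a, b, East) \in steps B) = ~~ allowed (a + b) (b%:Z - 1).
Proof.
move: here; rewrite mem_steps sB abn ?eq_East /allowed !heightS /=.
case: (nth East T _ == North); case: (nth East B _ == North) => /=; lia.
Qed.

Lemma contactB_North : allowed (a + b).+1 (b%:Z + 1) ->
  ((a, b, North) \in steps B) = ~~ allowed (a + b).+1 b%:Z.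
Proof.
move: here; rewrite mem_steps sB abn ?eq_East /allowed !heightS /=.
case: (nth East B _ == North); case: (nth East T _ == North) => /=; lia.
Qed.

Lemma contactT_East : allowed (a + b).+1 b%:Z ->
  ((a, b, East) \in steps T) = ~~ allowed (a + b).+1 (b%:Z + 1).
Proof.
move: here; rewrite mem_steps sT abn ?eq_East /allowed !heightS /=.
case: (nth East B _ == North); case: (nth East T _ == North) => /=; lia.
Qed.

Lemma contactT_North : allowed (a + b).+1 (b%:Z + 1) ->
  ((a, b, North) \in steps T) = ~~ allowed (a + b) (b%:Z + 1).
Proof.
move: here; rewrite mem_steps sT abn ?eq_East /allowed !heightS /=.
case: (nth East B _ == North); case: (nth East T _ == North) => /=; lia.
Qed.
End Contact.

Variables (R : comNzRingType) (u v : R).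

(** Induction on the last letter, with the final height [k] left free for the prefixes. *)
Lemma sum_backward m k : (m <= n)%N ->
  \sum_(w <- words m | inside origin w && ((count_mem North w)%:Z == k))
     u ^+ bottom_contacts B w * v ^+ left_contacts T w =
  backward allowed u v 0 0 m k.
Proof.
elim: m k => [|m IHm] k mn.
  rewrite big_cons big_nil /= addr0 eq_sym /inside /= /allowed !height0 /=.
  by have [->|] := eqVneq k 0; rewrite ?andbF ?if_same // mulr1.
rewrite sum_words_rcons /= add0n.
(* If the end is outside the region, both sums are empty. *)
have [Ak|/negbTE Ak] := boolP (allowed m.+1 k); last first.
  by rewrite !big1_seq ?addr0 // => w; rewrite inside_rcons count_rcons_North mem_words;
     case/andP=> /andP[/andP[_ +] /eqP e] /eqP sw; rewrite e sw Ak.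
rewrite !reach_from_origin -!IHm ?(ltnW mn) // !big_distrr /=.
congr (_ + _); rewrite big_seq_cond [RHS]big_seq_cond; apply: eq_big => w.
- rewrite mem_words inside_rcons count_rcons_North eqxx.
  have [sw|//] := eqVneq (size w) m; rewrite sw /=.
  have [e|ne] := eqVneq (count_mem North w)%:Z (k - 1).
    have -> : (count_mem North w + 1)%N%:Z = k by lia.
    by rewrite Ak eqxx !andbT.
  have /negbTE -> : (count_mem North w + 1)%N%:Z != k by lia.
  by rewrite !andbF.
- rewrite mem_words inside_rcons count_rcons_North eqxx.
  case/andP=> /eqP sw /andP[/andP[/inside_last aw _] /eqP ek].
  have ep : (size w - count_mem North w + count_mem North w = m)%N.
    by rewrite subnK ?count_size.
  rewrite /bottom_contacts /left_contacts !contacts_rcons end_pointE /= addn0.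
  rewrite sw in aw; have kE : k = (count_mem North w)%:Z + 1 by lia.
  rewrite contactT_North ?ep // -?kE // exprD.
  by case: (allowed m k); rewrite /= ?expr0 ?expr1; ring.
- rewrite mem_words inside_rcons count_rcons_North /= addn0.
  have [sw|//] := eqVneq (size w) m; rewrite sw /=.
  have [->|_] := eqVneq (count_mem North w)%:Z k; first by rewrite Ak !andbT.
  by rewrite !andbF.
- rewrite mem_words inside_rcons count_rcons_North /= addn0.
  case/andP=> /eqP sw /andP[/andP[/inside_last aw _] /eqP ek].
  have ep : (size w - count_mem North w + count_mem North w = m)%N.
    by rewrite subnK ?count_size.
  rewrite /bottom_contacts /left_contacts !contacts_rcons end_pointE /= addn0.
  rewrite sw in aw; rewrite contactB_East ?ep // ek // exprD.
  by case: (allowed m (k - 1)); rewrite /= ?expr0 ?expr1; ring.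
Qed.

(** Induction on the first letter, with the starting point left free for the suffixes. *)
Lemma sum_forward m a b : (a + b + m)%N = n ->
  \sum_(w <- words m | inside (a, b) w && (b + count_mem North w == y)%N)
     u ^+ contacts_from (a, b) East w T * v ^+ contacts_from (a, b) North w B =
  forward allowed u v (a + b) b%:Z m y%:Z.
Proof.
elim: m a b => [|m IHm] a b abm.
  rewrite big_cons big_nil /= addr0 addn0 /inside /= andbT mulr1 eqz_nat eq_sym.
  by case: (allowed _ _); case: (y == b).
have contacts_cons s d Q w : contacts_from (a, b) d (s :: w) Q =
    (((s == d) && ((a, b, s) \in steps Q)) + contacts_from (move (a, b) s) d w Q)%N.
  by [].
rewrite sum_words_cons.
under eq_bigl do rewrite inside_cons.
under [X in _ + X]eq_bigl do rewrite inside_cons.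
rewrite [forward _ _ _ _ _ _ _]/=.
have [here|no] := boolP (allowed (a + b) b%:Z); last first.
  by rewrite !big1 ?addr0 // => w; rewrite (negbTE no).
have abn : (a + b < n)%N by lia.
rewrite !reach_to_end; try lia.
have eb : b%:Z + 1 = b.+1%:Z by lia.
have eN : (a + b).+1 = (a + b.+1)%N by lia.
have eE : (a + b).+1 = (a.+1 + b)%N by lia.
congr (_ + _).
- rewrite {2}eN eb -IHm; last by lia.
  rewrite big_distrr /=; apply: eq_big => w; first by rewrite add1n addSnnS.
  case/andP=> /andP[there _] _; rewrite !contacts_cons /= add0n.
  rewrite contactB_North // ?eb ?eN // -?eN exprD.
  by case: (allowed (a + b).+1 b); rewrite /= ?expr0 ?expr1; ring.
- rewrite {2}eE -IHm; last by lia.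
  rewrite big_distrr /=; apply: eq_big => w; first by [].
  case/andP=> /andP[there _] _; rewrite !contacts_cons /= add0n.
  rewrite contactT_East // ?eE // -?eE exprD.
  by case: (allowed (a + b).+1 (b%:Z + 1)); rewrite /= ?expr0 ?expr1; ring.
Qed.

Lemma tutte_sums :
  \sum_(w <- words n | inside origin w && (count_mem North w == y))
     u ^+ bottom_contacts B w * v ^+ left_contacts T w =
  \sum_(w <- words n | inside origin w && (count_mem North w == y))
     u ^+ top_contacts T w * v ^+ right_contacts B w.
Proof.
have := sum_forward (m := n) (a := 0) (b := 0) (erefl _).
rewrite -(backward_forward allowed_convex) -sum_backward //.
Qed.
End Boundaries.

(** * Back to [paths_between]: generating functions and cardinalities *)

Section PathsBetween.
Variables (x y : nat) (T B : seq step).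
Hypotheses (hT : end_point T = (x, y)) (hB : end_point B = (x, y)).
Hypothesis hTB : weakly_above T B.

Lemma paths_betweenE (P : (x + y).-tuple step) :
  (P \in paths_between x y T B) = inside T B origin P && (count_mem North P == y).
Proof.
have sP := size_tuple P; have cP := count_size (pred1 North) P.
have sT := end_point_size hT; have sB := end_point_size hB.
have yT : count_mem North T = y by move: hT; rewrite end_pointE => -[].
have yB : count_mem North B = y by move: hB; rewrite end_pointE => -[].
have EP : (end_point P == (x, y)) = (count_mem North P == y).
  by rewrite end_pointE sP; apply/eqP/eqP => [[]//|->]; rewrite addnK.
rewrite inE EP andbC; case: (eqVneq (count_mem North P) y) => [yP|_];
  last by rewrite !andbF.
rewrite !andbT.
have endP : end_point P = (x, y) by apply/eqP; rewrite EP yP.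
rewrite -[inside _ _ _ _]/(all _ (points P)).
apply/idP/(all_nthP origin) => [/andP[bP aP] i|ins].
  rewrite size_points ltnS => iP.
  have -> := nth_points origin iP; rewrite /= subnK ?height_le // /allowed.
  have := elimT (weakly_aboveP (etrans endP (esym hB))) bP i.
  by have := elimT (weakly_aboveP (etrans hT (esym endP))) aP i; lia.
have le i : (height B i <= height P i <= height T i)%N.
  (* [inside] only controls indices up to the length; beyond it all three heights equal [y]. *)
  have [iP|/ltnW iP] := leqP i (size P); last first.
    by rewrite !height_oversize ?sT ?sB -?sP // yT yB yP leqnn.
  have := ins i; rewrite size_points ltnS iP => /(_ isT).
  by have -> := nth_points origin iP; rewrite /= subnK ?height_le // /allowed.
by apply/andP; split; apply/weakly_aboveP; rewrite ?endP ?hT ?hB // => i;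
  case/andP: (le i).
Qed.

Lemma contact_sums (R : comNzRingType) (u v : R) :
  \sum_(P in paths_between x y T B) u ^+ bottom_contacts B P * v ^+ left_contacts T P =
  \sum_(P in paths_between x y T B) u ^+ top_contacts T P * v ^+ right_contacts B P.
Proof.
have sumE (F : seq step -> R) : \sum_(P in paths_between x y T B) F P =
    \sum_(w <- words (x + y) | inside T B origin w && (count_mem North w == y)) F w.
  rewrite (eq_bigl _ _ paths_betweenE).
  exact: (sum_tuples _ (fun w => inside T B origin w && (count_mem North w == y))).
have EBT : end_point T = end_point B by rewrite hT hB.
rewrite (sumE (fun w => u ^+ bottom_contacts B w * v ^+ left_contacts T w)).
rewrite (sumE (fun w => u ^+ top_contacts T w * v ^+ right_contacts B w)).
apply: tutte_sums; try exact: end_point_size.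
- by move: hT; rewrite end_pointE => -[].
- by move: hB; rewrite end_pointE => -[].
- by move=> i; apply: (weakly_aboveP EBT).
Qed.
End PathsBetween.

(** The outer variable ['X] marks [f] and the inner one ['X%:P] marks [g], so coefficients count
    joint values. *)
Lemma coef_sum_monomials (I : finType) (S : {set I}) (f g : I -> nat) i j :
  (\sum_(t in S) ('X ^+ f t * 'X%:P ^+ g t : {poly {poly int}}))`_i`_j =
  #|[set t in S | (f t == i) && (g t == j)]|%:Z.
Proof.
rewrite -[RHS]natz -sum1_card natr_sum !coef_sum.
rewrite [RHS](eq_bigl (fun t => (t \in S) && ((f t == i) && (g t == j)))); last first.
  by move=> t; rewrite inE.
rewrite [RHS]big_mkcondr /=; apply: eq_bigr => t _.
rewrite -polyC_exp coefMC coefXn mulr_natl coefMn coefXn (eq_sym i) (eq_sym j).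
by case: (f t == i); case: (g t == j).
Qed.

Theorem theorem2p2 (x y : nat) (T B : seq step)
    (hT : end_point T = (x, y)) (hB : end_point B = (x, y))
    (hTB : weakly_above T B) :
  (forall i j : nat,
     #|[set P in paths_between x y T B |
         (bottom_contacts B P == i) && (left_contacts T P == j)]| =
     #|[set P in paths_between x y T B |
         (top_contacts T P == i) && (right_contacts B P == j)]|) /\
  (forall (R : comNzRingType) (u v : R),
     \sum_(P in paths_between x y T B)
       u ^+ bottom_contacts B P * v ^+ left_contacts T P =
     \sum_(P in paths_between x y T B)
       u ^+ top_contacts T P * v ^+ right_contacts B P).
Proof.
have sums := contact_sums hT hB hTB.
split; last exact: sums.
(* Take [u] and [v] to be the two variables of [{poly {poly int}}] and compare coefficients. *)
by move=> i j; apply/eqP; rewrite -eqz_nat -!coef_sum_monomials sums.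
Qed.
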